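(* With the setting and notation of the context, let $1\leqslant\eta\leqslant n-1$, let $0\leqslant v_1<\cdots<v_\eta\leqslant N$, let $l_1\geqslant l_2$ be positive integers with $l_1+l_2=c+r+n-\eta$ $(=N-\eta)$, and let $1\leqslant i_1<\cdots<i_{l_1}\leqslant c+r$ and $1\leqslant j_1<\cdots<j_{l_2}\leqslant c$ be ascending sequences with $\{j_1,\dots,j_{l_2}\}\subset\{i_1,\dots,i_{l_1}\}$. Then the regular symmetric horizontal differential $l_2$-form ${}_{v_1,\dots,v_\eta}\widehat\omega_{j_1,\dots,j_{l_2}}^{i_1,\dots,i_{l_1}}$ on ${}_{v_1,\dots,v_\eta}\widehat X$ is the image of a twisted regular symmetric differential $l_2$-form $${}_{v_1,\dots,v_\eta}\omega_{j_1,\dots,j_{l_2}}^{i_1,\dots,i_{l_1}}\in\Gamma\big({}_{v_1,\dots,v_\eta}X,\mathsf{Sym}^{l_2}\,\Omega_V(\heartsuit)\big)$$ under the canonical injection $\Gamma\big({}_{v_1,\dots,v_\eta}X,\mathsf{Sym}^{l_2}\Omega_V(\heartsuit)\big)\hookrightarrow\Gamma\big({}_{v_1,\dots,v_\eta}\widehat X,\mathsf{Sym}^{l_2}\Omega_{\mathrm{hor}}\widehat V\big)$, where the twisted degree is $$\heartsuit={}_{v_1,\dots,v_\eta}\heartsuit_{j_1,\dots,j_{l_2}}^{i_1,\dots,i_{l_1}}:=\sum_{p=1}^{l_1}\deg F_{i_p}+\sum_{q=1}^{l_2}\deg F_{j_q}-\Big(\sum_{j=0}^N\lambda_j-\sum_{\mu=1}^{\eta}\lambda_{v_\mu}\Big)+(N-\eta)+1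 .$$ Furthermore, for all homogeneous polynomials $P\in\Gamma(\mathbb{P}^N,\mathcal{O}_{\mathbb{P}^N}(\deg P))$, multiplication gives further twisted regular symmetric differential $l_2$-forms $$P\;{}_{v_1,\dots,v_\eta}\omega_{j_1,\dots,j_{l_2}}^{i_1,\dots,i_{l_1}}\in\Gamma\big({}_{v_1,\dots,v_\eta}X,\mathsf{Sym}^{l_2}\,\Omega_V(\deg P+\heartsuit)\big).$$
   Context: $\mathbb{K}$ is an algebraically closed field; $N\geqslant 2$ and $c,r\geqslant 0$ are integers with $2c+r\geqslant N$, $c+r\leqslant N-1$, and $n:=N-(c+r)$. Let $d_1,\dots,d_{c+r}$ be positive integers and let $\lambda_0,\dots,\lambda_N\geqslant 2$ be integers, and let $$F_i=\sum_{j=0}^N A_i^j\,z_j^{\lambda_j}\qquad(i=1,\dots,c+r),$$ where $A_i^j\in\mathbb{K}[z_0,\dots,z_N]$ are homogeneous with $\deg A_i^j+\lambda_j=\deg F_i=d_i$. Let $V=\{F_1=\cdots=F_c=0\}\subset\mathbb{P}^N_{\mathbb{K}}$ and $X=\{F_1=\cdots=F_{c+r}=0\}\subset V$, both assumed to be smooth complete intersections, and let ${}_{v_1,\dots,v_\eta}X:=X\cap\{z_{v_1}=0\}\cap\cdots\cap\{z_{v_\eta}=0\}$ (as a $\mathbb{K}$-variety). Let $\pi:\mathbb{K}^{N+1}\setminus\{0\}\to\mathbb{P}^N_{\mathbb{K}}$ be the projection, $\widehat V=\pi^{-1}(V)$, ${}_{v_1,\dots,v_\eta}\widehat X=\pi^{-1}({}_{v_1,\dots,v_\eta}X)$.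 The horizontal tangent bundle $\mathrm{T}_{\mathrm{hor}}\widehat V$ has fibre $\{[\xi]\in\mathbb{K}^{N+1}/\mathbb{K}z: dF_i|_z(\xi)=0,\ i=1,\dots,c\}$ at $z\in\widehat V$; $\Omega_{\mathrm{hor}}\widehat V$ is its dual; and $\mathsf{Sym}^l\Omega_V(\heartsuit):=\mathsf{Sym}^l\Omega_V\otimes\mathcal{O}_V(\heartsuit)$. For $Y={}_{v_1,\dots,v_\eta}X$ with cone $\widehat Y$ there is a canonical injection $\Gamma(Y,\mathsf{Sym}^l\Omega_V(\heartsuit))\hookrightarrow\Gamma(\widehat Y,\mathsf{Sym}^l\Omega_{\mathrm{hor}}\widehat V)$ (pullback by $\pi$) whose image is the set of sections $\Phi$ with $\Phi(\lambda z,[\lambda\xi])=\lambda^{\heartsuit}\Phi(z,[\xi])$ for all $z\in\widehat Y$, $[\xi]\in\mathrm{T}_{\mathrm{hor}}\widehat V|_z$, $\lambda\in\mathbb{K}^\times$. Set $\widetilde{\mathsf A}_i^j:=A_i^jz_j$ and $\mathsf B_i^j:=z_j\,dA_i^j+\lambda_jA_i^j\,dz_j$, and let $\mathsf C$ be the $(c+r+c)\times(N+1)$ matrix whose $i$-th row is $(\widetilde{\mathsf A}_i^0,\dots,\widetilde{\mathsf A}_i^N)$ for $i=1,\dots,c+r$ and whose $(c+r+i)$-th row is $(\mathsf B_i^0,\dots,\mathsf B_i^N)$ for $i=1,\dots,c$. Write $\{0,\dots,N\}\setminus\{v_1,\dots,v_\eta\}=\{r_0<r_1<\cdots<r_{N-\eta}\}$.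 Let ${}_{v_1,\dots,v_\eta}\mathsf C_{j_1,\dots,j_{l_2}}^{i_1,\dots,i_{l_1}}$ be the $(N-\eta)\times(N-\eta+1)$ submatrix of $\mathsf C$ given by the rows $i_1,\dots,i_{l_1},c+r+j_1,\dots,c+r+j_{l_2}$ and by all columns except the columns $v_1+1,\dots,v_\eta+1$; let ${}_{v_1,\dots,v_\eta}\widehat{\mathsf C}_{j_1,\dots,j_{l_2};r_j}^{i_1,\dots,i_{l_1}}$ be the square matrix obtained from it by deleting the column coming from the $(r_j+1)$-th column of $\mathsf C$. On ${}_{v_1,\dots,v_\eta}\widehat X\cap\{z_{r_j}\neq0\}$ put $${}_{v_1,\dots,v_\eta}\widehat\omega_{j_1,\dots,j_{l_2};r_j}^{i_1,\dots,i_{l_1}}:=\frac{(-1)^j}{z_{r_j}^{\lambda_{r_j}-1}}\det\Big({}_{v_1,\dots,v_\eta}\widehat{\mathsf C}_{j_1,\dots,j_{l_2};r_j}^{i_1,\dots,i_{l_1}}\Big)\qquad(j=0,\dots,N-\eta),$$ where $1$-forms are multiplied in the symmetric algebra. These local forms are sections of $\mathsf{Sym}^{l_2}\Omega_{\mathrm{hor}}\widehat V$ which agree on overlaps, and ${}_{v_1,\dots,v_\eta}\widehat\omega_{j_1,\dots,j_{l_2}}^{i_1,\dots,i_{l_1}}\in\Gamma({}_{v_1,\dots,v_\eta}\widehat X,\mathsf{Sym}^{l_2}\Omega_{\mathrm{hor}}\widehat V)$ denotes the form obtained by gluing them. *)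

(* Defs.v *)
From mathcomp Require Import all_boot all_order all_algebra.
From mathcomp Require Export mpoly.

Set Implicit Arguments.
Unset Strict Implicit.
Unset Printing Implicit Defensive.

Import GRing.Theory.
Local Open Scope ring_scope.

(* Varieties over the algebraically closed field K are handled through their
   K-points: a subvariety of P^N is given by its affine cone minus the origin,
   a predicate on row vectors of length N + 1. *)

(** * Symmetric differential forms on affine space *)

(* Sym(Omega) of affine (N+1)-space: polynomials in dz_0, ..., dz_N (the outer
   variables) with coefficients in K[z_0, ..., z_N]. *)
Notation symform K n := {mpoly {mpoly K[n]}[n]}.

Definition dz (K : closedFieldType) (N : nat) (k : 'I_N.+1) : symform K N.+1 :=
  'X_k.

Definition diff (K : closedFieldType) (N : nat) (p : {mpoly K[N.+1]}) :
  symform K N.+1 := \sum_(k < N.+1) (p^`M(k))%:MP * dz K k.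

(* value of a symmetric form at the point z on the tangent vector xi *)
Definition sym_eval (K : closedFieldType) (N : nat) (G : symform K N.+1)
  (z xi : 'rV[K]_N.+1) : K := (map_mpoly (meval (z 0)) G).@[xi 0].

(** * Complete intersections and their tangent spaces *)

Definition cone (K : closedFieldType) (N m : nat)
  (F : 'I_m -> {mpoly K[N.+1]}) (z : 'rV[K]_N.+1) : Prop :=
  z != 0 /\ forall i, (F i).@[z 0] = 0.

(* Jacobian criterion: the m differentials are independent at every point of
   the scheme {F_1 = ... = F_m = 0}.  This is smoothness together with
   codimension m. *)
Definition smooth_ci (K : closedFieldType) (N m : nat)
  (F : 'I_m -> {mpoly K[N.+1]}) : Prop :=
  forall z, cone F z ->
    row_free (\matrix_(i < m, j < N.+1) ((F i)^`M(j)).@[z 0]).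

(* xi represents a class of T_hor at z, a subspace of K^{N+1} / K z. *)
Definition tangent (K : closedFieldType) (N m : nat)
  (F : 'I_m -> {mpoly K[N.+1]}) (z xi : 'rV[K]_N.+1) : Prop :=
  forall i, sym_eval (diff (F i)) z xi = 0.

(** * Regular sections of Sym^l of a cotangent bundle *)

(* K being infinite, Sym^l(W^* ) is identified with the degree l homogeneous
   polynomial functions on the vector space W.  A section over the locally
   closed set Y of Sym^l of the dual of a subbundle T of the trivial bundle
   K^{N+1} is thus a function Phi z xi (z in Y, xi in T_z) which near each point
   is the restriction of a form homogeneous of degree l in the dz_k, with
   coefficients rational functions regular at this point.  The values of Phi
   outside of T are irrelevant. *)
Definition regular_sym_form (K : closedFieldType) (N : nat)
  (Y : 'rV[K]_N.+1 -> Prop) (T : 'rV[K]_N.+1 -> 'rV[K]_N.+1 -> Prop)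
  (l : nat) (Phi : 'rV[K]_N.+1 -> 'rV[K]_N.+1 -> K) : Prop :=
  forall z0, Y z0 ->
    exists (Q : {mpoly K[N.+1]}) (G : symform K N.+1),
      [/\ Q.@[z0 0] != 0, G \is l.-homog &
        forall z xi, Y z -> Q.@[z 0] != 0 -> T z xi ->
          Phi z xi = sym_eval G z xi / Q.@[z 0]].

(* Gamma(Yhat, Sym^l Omega_hor Vhat), Vhat being the cone of FV and Yhat a
   subvariety of it: the second condition says that Phi z only depends on the
   class of xi modulo K z. *)
Definition horizontal_section (K : closedFieldType) (N m : nat)
  (FV : 'I_m -> {mpoly K[N.+1]}) (Yhat : 'rV[K]_N.+1 -> Prop) (l : nat)
  (Phi : 'rV[K]_N.+1 -> 'rV[K]_N.+1 -> K) : Prop :=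
  regular_sym_form Yhat (tangent FV) l Phi /\
  forall z xi t, Yhat z -> tangent FV z xi -> Phi z (xi + t *: z) = Phi z xi.

(* The affine chart U_k = {z_k != 0} of P^N is identified with the hyperplane
   {x_k = 1} of K^{N+1}, with tangent vectors in {v_k = 0}. *)
Definition chart (K : closedFieldType) (N : nat) (Yhat : 'rV[K]_N.+1 -> Prop)
  (k : 'I_N.+1) (x : 'rV[K]_N.+1) : Prop := Yhat x /\ x 0 k = 1.

Definition chart_tangent (K : closedFieldType) (N m : nat)
  (FV : 'I_m -> {mpoly K[N.+1]}) (k : 'I_N.+1) (x v : 'rV[K]_N.+1) : Prop :=
  tangent FV x v /\ v 0 k = 0.

(* the projection z |-> z / z_k to the chart U_k, and its differential *)
Definition to_chart (K : closedFieldType) (N : nat) (k : 'I_N.+1)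
  (z : 'rV[K]_N.+1) : 'rV[K]_N.+1 := (z 0 k)^-1 *: z.

Definition dto_chart (K : closedFieldType) (N : nat) (k : 'I_N.+1)
  (z xi : 'rV[K]_N.+1) : 'rV[K]_N.+1 :=
  (z 0 k)^-1 *: xi - (xi 0 k / z 0 k ^+ 2) *: z.

(* Gamma(Y, Sym^l Omega_V (h)): regular sections s k of Sym^l Omega_V over
   Y inter U_k, glued by the transition functions (z_m / z_k)^h of O(h) with
   respect to its generators z_k^h. *)
Definition twisted_section (K : closedFieldType) (N m : nat)
  (FV : 'I_m -> {mpoly K[N.+1]}) (Yhat : 'rV[K]_N.+1 -> Prop) (l : nat)
  (h : int) (s : 'I_N.+1 -> 'rV[K]_N.+1 -> 'rV[K]_N.+1 -> K) : Prop :=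
  (forall k, regular_sym_form (chart Yhat k) (chart_tangent FV k) l (s k)) /\
  (forall k k' x v, chart Yhat k x -> chart_tangent FV k x v -> x 0 k' != 0 ->
     s k x v = x 0 k' ^ h * s k' (to_chart k' x) (dto_chart k' x v)).

(* The canonical injection: pullback by pi.  On {z_k != 0} it is
   z_k^h (pi^* s_k); by the gluing condition the chosen k does not matter. *)
Definition pullback (K : closedFieldType) (N : nat) (h : int)
  (s : 'I_N.+1 -> 'rV[K]_N.+1 -> 'rV[K]_N.+1 -> K)
  (z xi : 'rV[K]_N.+1) : K :=
  if [pick k | z 0 k != 0] is Some k
  then z 0 k ^ h * s k (to_chart k z) (dto_chart k z xi) else 0.

(* P s for P homogeneous of degree e; on U_k, P is P(z / z_k) z_k^e. *)
Definition mul_section (K : closedFieldType) (N : nat) (P : {mpoly K[N.+1]})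
  (s : 'I_N.+1 -> 'rV[K]_N.+1 -> 'rV[K]_N.+1 -> K) :
  'I_N.+1 -> 'rV[K]_N.+1 -> 'rV[K]_N.+1 -> K :=
  fun k x v => P.@[x 0] * s k x v.

(** * The explicit forms *)

Definition fermat (K : closedFieldType) (N m : nat)
  (A : 'I_m -> 'I_N.+1 -> {mpoly K[N.+1]}) (lam : 'I_N.+1 -> nat) (i : 'I_m) :
  {mpoly K[N.+1]} := \sum_(j < N.+1) A i j * 'X_j ^+ lam j.

Definition fermatV (K : closedFieldType) (N c r : nat)
  (A : 'I_(c + r) -> 'I_N.+1 -> {mpoly K[N.+1]}) (lam : 'I_N.+1 -> nat)
  (i : 'I_c) : {mpoly K[N.+1]} := fermat A lam (lshift r i).

(* the cone of X inter {z_v = 0 for all listed v} *)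
Definition coneX (K : closedFieldType) (N m eta : nat)
  (A : 'I_m -> 'I_N.+1 -> {mpoly K[N.+1]}) (lam : 'I_N.+1 -> nat)
  (v : 'I_eta -> 'I_N.+1) (z : 'rV[K]_N.+1) : Prop :=
  cone (fermat A lam) z /\ forall mu, z 0 (v mu) = 0.

Definition Atilde (K : closedFieldType) (N m : nat)
  (A : 'I_m -> 'I_N.+1 -> {mpoly K[N.+1]}) (i : 'I_m) (j : 'I_N.+1) :
  symform K N.+1 := (A i j * 'X_j)%:MP.

Definition Bform (K : closedFieldType) (N m : nat)
  (A : 'I_m -> 'I_N.+1 -> {mpoly K[N.+1]}) (lam : 'I_N.+1 -> nat)
  (i : 'I_m) (j : 'I_N.+1) : symform K N.+1 :=
  ('X_j)%:MP * diff (A i j) + (A i j *+ lam j)%:MP * dz K j.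

Definition Cmx (K : closedFieldType) (N c r : nat)
  (A : 'I_(c + r) -> 'I_N.+1 -> {mpoly K[N.+1]}) (lam : 'I_N.+1 -> nat) :
  'M[symform K N.+1]_(c + r + c, N.+1) :=
  col_mx (\matrix_(i < c + r, j < N.+1) Atilde A i j)
         (\matrix_(i < c, j < N.+1) Bform A lam (lshift r i) j).

(* r_j: the j-th element, from 0, of the complement of {v_1, ..., v_eta} in
   {0, ..., N}, in increasing order; relevant for j <= N - eta only *)
Definition remaining (N eta : nat) (v : 'I_eta -> 'I_N.+1) (j : nat) :
  'I_N.+1 := nth ord0 [seq k <- enum 'I_N.+1 | k \notin codom v] j.

Definition sel_row (c r l1 l2 : nat) (i : 'I_l1 -> 'I_(c + r))
  (j : 'I_l2 -> 'I_c) (s : 'I_(l1 + l2)) : 'I_(c + r + c) :=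
  match split s with
  | inl p => lshift c (i p)
  | inr q => rshift (c + r) (j q)
  end.

(* Since l1 + l2 = N - eta, the N - eta + 1 columns are indexed by
   'I_(l1 + l2).+1. *)
Definition Csub (K : closedFieldType) (N c r eta l1 l2 : nat)
  (A : 'I_(c + r) -> 'I_N.+1 -> {mpoly K[N.+1]}) (lam : 'I_N.+1 -> nat)
  (v : 'I_eta -> 'I_N.+1) (i : 'I_l1 -> 'I_(c + r)) (j : 'I_l2 -> 'I_c) :
  'M[symform K N.+1]_(l1 + l2, (l1 + l2).+1) :=
  mxsub (sel_row i j) (fun t : 'I_(l1 + l2).+1 => remaining v t) (Cmx A lam).

Definition Chat (K : closedFieldType) (N c r eta l1 l2 : nat)
  (A : 'I_(c + r) -> 'I_N.+1 -> {mpoly K[N.+1]}) (lam : 'I_N.+1 -> nat)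
  (v : 'I_eta -> 'I_N.+1) (i : 'I_l1 -> 'I_(c + r)) (j : 'I_l2 -> 'I_c)
  (t : 'I_(l1 + l2).+1) : 'M[symform K N.+1]_(l1 + l2) :=
  col' t (Csub A lam v i j).

(* the local form on {z_(r_t) != 0} *)
Definition omega_loc (K : closedFieldType) (N c r eta l1 l2 : nat)
  (A : 'I_(c + r) -> 'I_N.+1 -> {mpoly K[N.+1]}) (lam : 'I_N.+1 -> nat)
  (v : 'I_eta -> 'I_N.+1) (i : 'I_l1 -> 'I_(c + r)) (j : 'I_l2 -> 'I_c)
  (t : 'I_(l1 + l2).+1) (z xi : 'rV[K]_N.+1) : K :=
  (-1) ^+ t / z 0 (remaining v t) ^+ (lam (remaining v t)).-1
  * sym_eval (\det (Chat A lam v i j t)) z xi.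

(* the glued form: the value of any local form defined at z *)
Definition omega_hat (K : closedFieldType) (N c r eta l1 l2 : nat)
  (A : 'I_(c + r) -> 'I_N.+1 -> {mpoly K[N.+1]}) (lam : 'I_N.+1 -> nat)
  (v : 'I_eta -> 'I_N.+1) (i : 'I_l1 -> 'I_(c + r)) (j : 'I_l2 -> 'I_c)
  (z xi : 'rV[K]_N.+1) : K :=
  if [pick t : 'I_(l1 + l2).+1 | z 0 (remaining v t) != 0] is Some t
  then omega_loc A lam v i j t z xi else 0.

(* the twisted degree; d i is deg F_i *)
Definition heart (N c r eta l1 l2 : nat) (d : 'I_(c + r) -> nat)
  (lam : 'I_N.+1 -> nat) (v : 'I_eta -> 'I_N.+1)
  (i : 'I_l1 -> 'I_(c + r)) (j : 'I_l2 -> 'I_c) : int :=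
  \sum_(p < l1) (d (i p))%:Z + \sum_(q < l2) (d (lshift r (j q)))%:Z
  - (\sum_(k < N.+1) (lam k)%:Z - \sum_(mu < eta) (lam (v mu))%:Z)
  + (N%:Z - eta%:Z) + 1.

(* Main.v *)
(** Along the cone, the column vector with entries z_(r_t)^(lambda_(r_t) - 1)
lies in the kernel of the evaluated matrix C: its A-rows give F_i(z) and its
B-rows give dF_i(z)(xi).  By Cramer's rule the signed maximal minors are
proportional to this vector, which glues the local forms.  By Euler's identity
B_i^j at xi + s z is B_i^j + s d_i A_i^j z_j, so B-rows only change by multiples
of A-rows that are present in the minor, and the form is horizontal.  Replacing
(z, xi) by (a z, a xi) multiplies row i, column j by a^(d_i - lambda_j + 1), so
the form is homogeneous of degree heart; a horizontal homogeneous form descends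
to each chart by restriction to the hyperplane {z_k = 1}. *)

Require Import Defs.
From mathcomp Require Import all_boot all_order all_algebra.
From mathcomp Require Import zify.

Set Implicit Arguments.
Unset Strict Implicit.
Unset Printing Implicit Defensive.

Import GRing.Theory.
Local Open Scope ring_scope.

(** * Determinants: scaling, row operations, homogeneity, maximal minors *)

Lemma prod_expz (F : fieldType) (I : finType) (a : F) (e : I -> int) :
  a != 0 -> \prod_k a ^ e k = a ^ (\sum_k e k).
Proof.
move=> a0; elim/big_rec2: _ => [|k y z _ ->]; first by rewrite expr0z.
by rewrite expfzDr.
Qed.

Lemma det_scale_rows_cols (R : comNzRingType) (n : nat) (a b : 'I_n -> R)
  (M M' : 'M[R]_n) :
  (forall s k, M' s k = a s * b k * M s k) ->
  \det M' = (\prod_s a s) * (\prod_k b k) * \det M.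
Proof.
move=> eM.
have -> : M' = diag_mx (\row_s a s) *m M *m diag_mx (\row_k b k).
  by apply/matrixP=> s k; rewrite mul_mx_diag mxE mul_diag_mx !mxE eM mulrAC.
rewrite !det_mulmx !det_diag mulrAC; congr (_ * _ * _);
  by apply: eq_bigr => s _; rewrite mxE.
Qed.

(** The row operation is left multiplication by a unipotent matrix. It serves to discard multiples
    of A-rows added to B-rows. *)
Lemma det_col_mx_addl (R : comNzRingType) (m n : nat)
  (U : 'M[R]_(m, m + n)) (D : 'M[R]_(n, m + n)) (Z : 'M[R]_(n, m)) :
  \det (col_mx U (D + Z *m U)) = \det (col_mx U D).
Proof.
have -> : col_mx U (D + Z *m U) = block_mx 1%:M 0 Z 1%:M *m col_mx U D.
  by rewrite mul_block_col !mul1mx mul0mx addr0 addrC.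
by rewrite det_mulmx det_lblock !det1 !mul1r.
Qed.

Lemma dhomog_prod_ord (n l : nat) (R : comNzRingType) (e : 'I_l -> nat)
  (p : 'I_l -> {mpoly R[n]}) :
  (forall s, p s \is (e s).-homog) -> \prod_s p s \is (\sum_s e s)%N.-homog.
Proof.
move=> hp; elim/big_rec2: _ => [|s y z _]; first exact: dhomog1.
exact: dhomogM.
Qed.

(** Each Leibniz term takes one entry from every row, so the row degrees add up. *)
Lemma dhomog_det (n l : nat) (R : comNzRingType) (e : 'I_l -> nat)
  (M : 'M[{mpoly R[n]}]_l) :
  (forall s k, M s k \is (e s).-homog) -> \det M \is (\sum_s e s)%N.-homog.
Proof.
move=> hM; apply: rpred_sum => s _; rewrite mulr_sign.
by case: ifP => _; rewrite ?rpredN; apply: dhomog_prod_ord.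
Qed.

(* Border M with the row w_t e_s - w_s e_t: the result kills w, hence is
   singular; expand its determinant along this row. *)
Lemma minors_proportional (F : fieldType) (l : nat) (M : 'M[F]_(l, l.+1))
  (w : 'cV[F]_l.+1) (s t : 'I_l.+1) : M *m w = 0 ->
  (-1) ^+ s * \det (col' s M) * w t 0 = (-1) ^+ t * \det (col' t M) * w s 0.
Proof.
move=> Mw; have [-> // | st] := eqVneq s t.
pose u : 'rV[F]_(l.+1) := w t 0 *: delta_mx 0 s - w s 0 *: delta_mx 0 t.
pose B : 'M[F]_(1 + l) := col_mx u M.
have cofB k : cofactor B 0 k = (-1) ^+ k * \det (col' k M).
  rewrite /cofactor add0n; congr (_ * \det _).
  apply/matrixP=> a b; rewrite !mxE.
  have -> : lift 0 a = rshift 1 a by apply: val_inj.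
  by rewrite (unsplitK (inr _ _)).
have detB : \det B = w t 0 * ((-1) ^+ s * \det (col' s M))
                   - w s 0 * ((-1) ^+ t * \det (col' t M)).
  have B0 k : B 0 k = u 0 k.
    by rewrite -(col_mxEu u M 0 k); congr (col_mx _ _ _ _); apply: val_inj.
  rewrite (expand_det_row _ 0) (bigD1 s) //= (bigD1 t) 1?eq_sym //= big1.
    rewrite addr0 !cofB !B0 !mxE !eqxx (negPf st) eq_sym (negPf st) /=.
    by rewrite mulr1 !mulr0 mulr1 subr0 sub0r mulNr.
  move=> k /andP[ks kt]; rewrite B0 !mxE (negPf ks) (negPf kt) andbF.
  by rewrite !mulr0 subr0 mul0r.
(* [det0P] below asks for a nonzero kernel vector; for [w = 0] both sides vanish. *)
have [->|w0] := eqVneq w 0; first by rewrite !mxE !mulr0.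
suff /eqP : \det B = 0.
  by rewrite detB subr_eq0 mulrC => /eqP ->; rewrite mulrC.
apply/eqP; rewrite -det_tr; apply/det0P; exists w^T.
  by apply: contra w0 => /eqP e; rewrite -[w]trmxK e trmx0.
rewrite -trmx_mul mul_col_mx Mw mulmxBl -!scalemxAl -!rowE.
suff -> : w t 0 *: row s w - w s 0 *: row t w = 0 by rewrite col_mx0 trmx0.
by apply/rowP=> k; rewrite !mxE ord1 mulrC subrr.
Qed.

(** * Homogeneous polynomials: scaling and Euler's identity *)

Lemma meval_homogZ (K : comNzRingType) (n e : nat) (p : {mpoly K[n]})
  (a : K) (z : 'rV[K]_n) :
  p \is e.-homog -> p.@[(a *: z) 0] = a ^+ e * p.@[z 0].
Proof.
move/dhomogP=> hp; rewrite !mevalE mulr_sumr.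
apply: eq_big_seq => m /hp /= <-; rewrite mulrCA mdegE -prodrXr -big_split /=.
by congr (_ * _); apply: eq_bigr => k _; rewrite mxE exprMn.
Qed.

Lemma euler_homog (K : comNzRingType) (n e : nat) (p : {mpoly K[n]}) :
  p \is e.-homog -> \sum_k p^`M(k) * 'X_k = p *+ e.
Proof.
move/dhomogP=> hp.
under eq_bigr => k _ do
  rewrite {1}[p]mpolyE linear_sum /= mulr_suml.
rewrite exchange_big /= [in RHS](mpolyE p) -sumrMnl.
apply: eq_big_seq => m /hp /= <-; rewrite mdegE -sumrMnr; apply: eq_bigr => k _.
rewrite mderivZ mderivX -!scalerAl scalerMnr; congr (_ *: _).
(* The subtraction [m - U_(k)] is truncated when [m k = 0], but then the coefficient [m k] kills the
   term. *)
have [->|mk] := eqVneq (m k) 0%N; first by rewrite scale0r mulr0n.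
by rewrite -mpolyXD submK ?lep1mP // scaler_nat.
Qed.

(** The derivative has degree e - 1; the factor [a] on the left avoids this subtraction and covers
    [e = 0]. *)
Lemma meval_mderivZ (K : comNzRingType) (n e : nat) (p : {mpoly K[n]})
  (a : K) (z : 'rV[K]_n) (k : 'I_n) : p \is e.-homog ->
  a * p^`M(k).@[(a *: z) 0] = a ^+ e * p^`M(k).@[z 0].
Proof.
move/dhomogP=> hp.
have -> : p^`M(k) = \sum_(m <- msupp p) p@_m *: ((m k)%:R *: 'X_[m - U_(k)]).
  rewrite {1}[p]mpolyE linear_sum; apply: eq_bigr => m _.
  by rewrite /= mderivZ mderivX.
rewrite !raddf_sum !mulr_sumr.
apply: eq_big_seq => m /hp /= dm; rewrite !mevalZ.
have [->|mk] := eqVneq (m k) 0%N; first by rewrite !(mul0r, mulr0).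
have de : (mdeg (m - U_(k))%MM).+1 = e.
  by rewrite -dm -[in RHS](@submK _ U_(k)%MM m) ?lep1mP // mdegD mdeg1 addn1.
have hX : ('X_[m - U_(k)] : {mpoly K[n]}) \is (mdeg (m - U_(k))).-homog.
  by rewrite dhomogX.
rewrite (meval_homogZ _ _ hX) -de exprS.
by rewrite -!mulrA; congr (a * _); rewrite [RHS]mulrCA; congr (_ * _); rewrite mulrCA.
Qed.

(** * Evaluation of symmetric forms and rules for differentials *)

Section SymEval.
Context (K : closedFieldType) (N : nat).
Implicit Types (p q : {mpoly K[N.+1]}) (G H : symform K N.+1).
Implicit Types z xi : 'rV[K]_N.+1.

Lemma sym_evalC p z xi : sym_eval p%:MP z xi = p.@[z 0].
Proof. by rewrite /sym_eval map_mpolyC mevalC. Qed.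

Lemma sym_eval_dz k z xi : sym_eval (dz K k) z xi = xi 0 k.
Proof. by rewrite /sym_eval map_mpolyX mevalXU. Qed.

Lemma sym_evalD G H z xi :
  sym_eval (G + H) z xi = sym_eval G z xi + sym_eval H z xi.
Proof. by rewrite /sym_eval !rmorphD. Qed.

Lemma sym_evalM G H z xi :
  sym_eval (G * H) z xi = sym_eval G z xi * sym_eval H z xi.
Proof. by rewrite /sym_eval !rmorphM. Qed.

Lemma sym_eval_sum (I : finType) (F : I -> symform K N.+1) z xi :
  sym_eval (\sum_k F k) z xi = \sum_k sym_eval (F k) z xi.
Proof. by rewrite /sym_eval (raddf_sum (map_mpoly _)) (raddf_sum (meval _)). Qed.

Lemma sym_eval_det l (M : 'M[symform K N.+1]_l) z xi :
  sym_eval (\det M) z xi = \det (map_mx (fun G => sym_eval G z xi) M).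
Proof.
rewrite /sym_eval -!det_map_mx; congr (\det _).
by apply/matrixP=> s t; rewrite !mxE.
Qed.

Lemma sym_eval_diff p z xi :
  sym_eval (diff p) z xi = \sum_k p^`M(k).@[z 0] * xi 0 k.
Proof.
rewrite sym_eval_sum; apply: eq_bigr => k _.
by rewrite sym_evalM sym_evalC sym_eval_dz.
Qed.

Lemma diffM p q : diff (p * q) = p%:MP * diff q + q%:MP * diff p.
Proof.
rewrite /diff !mulr_sumr -big_split; apply: eq_bigr => k _ /=.
by rewrite mderivM mpolyCD !mpolyCM mulrDl addrC !mulrA [q%:MP * _]mulrC.
Qed.

Lemma diff_sum (I : finType) (F : I -> {mpoly K[N.+1]}) :
  diff (\sum_k F k) = \sum_k diff (F k).
Proof.
rewrite /diff exchange_big; apply: eq_bigr => k _ /=.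
by rewrite linear_sum raddf_sum mulr_suml.
Qed.

Lemma diffX k : diff ('X_k : {mpoly K[N.+1]}) = dz K k.
Proof.
rewrite /diff (bigD1 k) //= big1 => [|m mk].
  rewrite mderivX mnm1E eqxx scale1r -{1}[U_(k)%MM]add0m addmK.
  by rewrite mpolyX0 mpolyC1 mul1r addr0.
by rewrite mderivX mnm1E eq_sym (negPf mk) scale0r mpolyC0 mul0r.
Qed.

Lemma diffXn k l :
  diff ('X_k ^+ l.+1 : {mpoly K[N.+1]}) = ('X_k ^+ l *+ l.+1)%:MP * dz K k.
Proof.
elim: l => [|l IH]; first by rewrite expr1 diffX expr0 mulr1n mpolyC1 mul1r.
rewrite exprS diffM IH diffX mulrA -mpolyCM -mulrDl -mpolyCD.
by rewrite mulrnAr -exprS -mulrSr.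
Qed.

Lemma sym_eval_diff_homogZ e p z xi a : p \is e.-homog ->
  sym_eval (diff p) (a *: z) (a *: xi) = a ^+ e * sym_eval (diff p) z xi.
Proof.
move=> hp; rewrite !sym_eval_diff mulr_sumr; apply: eq_bigr => k _.
by rewrite mxE mulrA [_ * a]mulrC (meval_mderivZ _ _ _ hp) mulrA.
Qed.

(** The differential is linear in [xi], and its value on the vector [z] is e p(z) by Euler's
    identity. *)
Lemma sym_eval_diff_homogD e p z xi s : p \is e.-homog ->
  sym_eval (diff p) z (xi + s *: z)
  = sym_eval (diff p) z xi + s * (p.@[z 0] *+ e).
Proof.
move=> hp; rewrite -mevalMn -(euler_homog hp) !sym_eval_diff raddf_sum mulr_sumr.
rewrite -big_split; apply: eq_bigr => k _ /=.
by rewrite mevalM mevalXU !mxE mulrDr mulrCA.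
Qed.

End SymEval.

(** * Entries of the matrix C: row relations, weights, Euler shift *)

Section Rows.
Context (K : closedFieldType) (N m : nat) (d : 'I_m -> nat).
Context (lam : 'I_N.+1 -> nat) (A : 'I_m -> 'I_N.+1 -> {mpoly K[N.+1]}).
Implicit Types z xi : 'rV[K]_N.+1.

Lemma sym_eval_Atilde i k z xi :
  sym_eval (Atilde A i k) z xi = (A i k).@[z 0] * z 0 k.
Proof. by rewrite sym_evalC mevalM mevalXU. Qed.

Lemma sym_eval_Bform i k z xi :
  sym_eval (Bform A lam i k) z xi
  = z 0 k * sym_eval (diff (A i k)) z xi + (A i k).@[z 0] *+ lam k * xi 0 k.
Proof. by rewrite sym_evalD !sym_evalM !sym_evalC sym_eval_dz mevalXU mevalMn. Qed.

Lemma sum_Atilde i z xi (hlam : forall k, (0 < lam k)%N) :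
  \sum_k sym_eval (Atilde A i k) z xi * z 0 k ^+ (lam k).-1
  = (fermat A lam i).@[z 0].
Proof.
rewrite [RHS]raddf_sum; apply: eq_bigr => k _ /=.
rewrite sym_eval_Atilde mevalM rmorphXn /= mevalXU.
by rewrite -mulrA -exprS prednK.
Qed.

(** Leibniz rule: the differential of A z^lam is z^(lam - 1) (z dA + lam A dz). *)
Lemma sum_Bform i z xi (hlam : forall k, (0 < lam k)%N) :
  \sum_k sym_eval (Bform A lam i k) z xi * z 0 k ^+ (lam k).-1
  = sym_eval (diff (fermat A lam i)) z xi.
Proof.
rewrite /fermat diff_sum sym_eval_sum; apply: eq_bigr => k _.
rewrite sym_eval_Bform diffM; have := hlam k; case: (lam k) => // l _.
rewrite diffXn sym_evalD !sym_evalM !sym_evalC sym_eval_dz.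
rewrite mevalMn !rmorphXn /= mevalXU mulrDl addrC /=; congr (_ + _).
  by rewrite !(mulrnAl, mulrnAr) -mulrA [xi 0 k * _]mulrC.
by rewrite exprS mulrAC.
Qed.

Context (hA : forall i k mm, mm \in msupp (A i k) -> (mdeg mm + lam k)%N = d i).

(** The zero coefficient is set apart because it satisfies [hA] even when [d i < lam k], where no
    natural degree e fits. *)
Lemma coef_homog i k :
  A i k = 0 \/ exists2 e, A i k \is e.-homog & (e + lam k)%N = d i.
Proof.
have [->|A0] := eqVneq (A i k) 0; [by left | right].
have led := hA (mlead_supp A0).
exists (d i - lam k)%N; last by rewrite -led addnK.
by apply/dhomogP => mm /hA <- /=; rewrite addnK.
Qed.

(* The exponent is an integer: d i < lam k - 1 may happen, when A i k = 0. *)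
Lemma Atilde_homogZ i k z xi a :
  sym_eval (Atilde A i k) (a *: z) (a *: xi)
  = a ^ ((d i)%:Z - (lam k)%:Z + 1) * sym_eval (Atilde A i k) z xi.
Proof.
rewrite !sym_eval_Atilde mxE; case: (coef_homog i k) => [->|[e he <-]].
  by rewrite !meval0 !mul0r mulr0.
rewrite PoszD addrK -PoszD addn1 -exprnP (meval_homogZ _ _ he) exprSr.
by rewrite mulrACA.
Qed.

Lemma Bform_homogZ i k z xi a :
  sym_eval (Bform A lam i k) (a *: z) (a *: xi)
  = a ^ ((d i)%:Z - (lam k)%:Z + 1) * sym_eval (Bform A lam i k) z xi.
Proof.
rewrite !sym_eval_Bform !mxE; case: (coef_homog i k) => [->|[e he <-]].
  rewrite !meval0 !mul0rn !mul0r !addr0 !sym_eval_diff !big1 ?mulr0 // => l _;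
    by rewrite mderiv0 meval0 mul0r.
rewrite PoszD addrK -PoszD addn1 -exprnP (meval_homogZ _ _ he).
rewrite (sym_eval_diff_homogZ _ _ _ he) mulrDr exprSr; congr (_ + _).
  by rewrite mulrACA [a * _]mulrC.
by rewrite -mulrnAr mulrACA.
Qed.

(** Euler's identity contributes deg A_i^k and the dz_k term contributes [lam k]. Their sum [d i]
    does not depend on the column, so the increment of a B-row is a multiple of the whole A-row. *)
Lemma Bform_euler i k z xi s :
  sym_eval (Bform A lam i k) z (xi + s *: z)
  = sym_eval (Bform A lam i k) z xi
    + s *+ d i * sym_eval (Atilde A i k) z xi.
Proof.
rewrite !sym_eval_Bform sym_eval_Atilde !mxE.
case: (coef_homog i k) => [->|[e he <-]].
  rewrite !meval0 !mul0rn !mul0r mulr0 !addr0 !sym_eval_diff !big1 ?mulr0 // => l _;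
    by rewrite mderiv0 meval0 mul0r.
rewrite (sym_eval_diff_homogD _ _ _ he) !mulrDr addrACA; congr (_ + _).
rewrite [in RHS]mulrnDr [in RHS]mulrDl; congr (_ + _).
  by rewrite mulrCA !(mulrnAl, mulrnAr) [z 0 k * _]mulrC.
by rewrite !(mulrnAl, mulrnAr) mulrCA.
Qed.

End Rows.

(** * The glued form on the cone *)

Lemma big_remaining (R : Type) (idx : R) (op : Monoid.com_law idx)
  (N eta l : nat) (v : 'I_eta -> 'I_N.+1) (F : 'I_N.+1 -> R) :
  injective v -> (l + eta = N.+1)%N ->
  \big[op/idx]_(t < l) F (remaining v t)
  = \big[op/idx]_(k | k \notin codom v) F k.
Proof.
move=> vI hl; rewrite -(eq_bigl _ _ (fun k => andTb (k \notin codom v))).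
rewrite -(big_enum_cond _ _ 'I_N.+1) -big_filter (big_nth ord0) big_mkord.
(* As [v] is injective, exactly [l] columns remain, so [nth] never returns its default [ord0]. *)
have -> // : size [seq k <- enum 'I_N.+1 | k \notin codom v] = l.
apply: (@addIn eta); have := cardC [in codom v].
rewrite card_codom // !card_ord addnC hl; apply: etrans.
congr (_ + _)%N; rewrite size_filter -sum1_count big_enum_cond sum1_card.
by apply: eq_card.
Qed.

Section Omega.
Context (K : closedFieldType) (N c r : nat) (d : 'I_(c + r) -> nat).
Context (lam : 'I_N.+1 -> nat) (hlam : forall k, (2 <= lam k)%N).
Context (A : 'I_(c + r) -> 'I_N.+1 -> {mpoly K[N.+1]}).
Context (hA : forall i k m, m \in msupp (A i k) -> (mdeg m + lam k)%N = d i).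
Context (eta : nat) (v : 'I_eta -> 'I_N.+1) (vI : injective v).
Context (l1 l2 : nat) (hl : ((l1 + l2).+1 + eta = N.+1)%N).
Context (i : 'I_l1 -> 'I_(c + r)) (j : 'I_l2 -> 'I_c).
Implicit Types (z xi : 'rV[K]_N.+1) (t : 'I_(l1 + l2).+1).

Local Notation rem := (remaining v).
Local Notation hs := (heart d lam v i j).

Lemma sel_row_lshift p : sel_row i j (lshift l2 p) = lshift c (i p).
Proof. by rewrite /sel_row (unsplitK (inl _ _)). Qed.

Lemma sel_row_rshift q : sel_row i j (rshift l1 q) = rshift (c + r) (j q).
Proof. by rewrite /sel_row (unsplitK (inr _ _)). Qed.

(** Evaluating before taking minors moves the linear algebra to the field [K]. *)
Definition Csub_eval z xi : 'M[K]_(l1 + l2, (l1 + l2).+1) :=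
  map_mx (fun G => sym_eval G z xi) (Csub A lam v i j).

Lemma Csub_eval_lshift p t z xi :
  Csub_eval z xi (lshift l2 p) t = sym_eval (Atilde A (i p) (rem t)) z xi.
Proof. by rewrite !mxE sel_row_lshift (unsplitK (inl _ _)) mxE. Qed.

Lemma Csub_eval_rshift q t z xi :
  Csub_eval z xi (rshift l1 q) t
  = sym_eval (Bform A lam (lshift r (j q)) (rem t)) z xi.
Proof. by rewrite !mxE sel_row_rshift (unsplitK (inr _ _)) mxE. Qed.

Lemma sym_eval_det_Chat t z xi :
  sym_eval (\det (Chat A lam v i j t)) z xi = \det (col' t (Csub_eval z xi)).
Proof. by rewrite sym_eval_det; congr (\det _); apply/matrixP=> s k; rewrite !mxE. Qed.

Lemma omega_locE t z xi :
  omega_loc A lam v i j t z xi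
  = (-1) ^+ t / z 0 (rem t) ^+ (lam (rem t)).-1 * \det (col' t (Csub_eval z xi)).
Proof. by rewrite /omega_loc sym_eval_det_Chat. Qed.

Lemma Csub_eval_kernel z xi : coneX A lam v z -> tangent (fermatV A lam) z xi ->
  Csub_eval z xi *m \col_t z 0 (rem t) ^+ (lam (rem t)).-1 = 0.
Proof.
move=> [[_ Fz] vz] Tz.
have lam0 k : (0 < lam k)%N by apply: leq_trans (hlam k).
(* The deleted columns may be put back: there z_v = 0 and the exponent lambda_v - 1 is positive,
   since lambda_v >= 2. *)
have total (f : 'I_N.+1 -> K) :
    \sum_(t < (l1 + l2).+1) f (rem t) * z 0 (rem t) ^+ (lam (rem t)).-1
    = \sum_k f k * z 0 k ^+ (lam k).-1.
  rewrite (big_remaining _ (fun k => f k * z 0 k ^+ (lam k).-1) vI hl).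
  rewrite [RHS](bigID [pred k | k \in codom v]) /= [X in _ = X + _]big1 ?add0r // => k.
  case/codomP=> mu ->; rewrite vz; have := hlam (v mu).
  by case: (lam _) => [|[|l]] //= _; rewrite exprS mul0r mulr0.
apply/matrixP=> s o; rewrite !mxE.
case: (split_ordP s) => [p|q] ->.
  under eq_bigr => t _ do rewrite Csub_eval_lshift mxE.
  by rewrite (total (fun k => sym_eval (Atilde A (i p) k) z xi)) sum_Atilde.
under eq_bigr => t _ do rewrite Csub_eval_rshift mxE.
by rewrite (total (fun k => sym_eval (Bform A lam _ k) z xi)) sum_Bform // Tz.
Qed.

Lemma omega_hatE t z xi : coneX A lam v z -> tangent (fermatV A lam) z xi ->
  z 0 (rem t) != 0 ->
  omega_hat A lam v i j z xi = omega_loc A lam v i j t z xi.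
Proof.
move=> Yz Tz zt; rewrite /omega_hat; case: pickP => [s zs|/(_ t)]; last by rewrite zt.
(* After cross-multiplication, equality of the local forms at [s] and [t] is this
   proportionality. *)
have := minors_proportional s t (Csub_eval_kernel Yz Tz).
rewrite !mxE => e; rewrite [LHS]omega_locE [RHS]omega_locE.
rewrite [LHS]mulrAC [RHS]mulrAC; apply/eqP.
by rewrite eqr_div ?expf_neq0 // e.
Qed.

Lemma exists_remaining_neq0 z : coneX A lam v z ->
  exists t : 'I_(l1 + l2).+1, z 0 (rem t) != 0.
Proof.
move=> [[z0 _] vz]; apply/existsP; apply: contraR z0 => /existsPn z0.
(* Counting nonzero coordinates turns the claim into a sum, to which [big_remaining] applies. *)
have /eqP : \sum_(t < (l1 + l2).+1) (z 0 (rem t) != 0 : nat) = 0%N.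
  by rewrite big1 // => t _; rewrite (negPf (z0 t)).
rewrite (big_remaining _ (fun k => z 0 k != 0 : nat) vI hl) sum_nat_eq0.
move/forallP=> h; apply/eqP/rowP=> k; rewrite mxE.
have [/codomP[mu ->]|kv] := boolP (k \in codom v); first exact: vz.
by have := implyP (h k) kv; case: (eqVneq (z 0 k) 0).
Qed.

(** The twisted degree as seen from chart [t]: row weights, weights of the columns kept, and the
    degree of the prefactor z_(r_t)^-(lambda - 1), which stands for the deleted column. The N - eta
    + 1 remaining columns contribute 1 each. *)
Lemma heartE t : hs = \sum_s (match split s with
    inl p => (d (i p))%:Z | inr q => (d (lshift r (j q)))%:Z end)
  + \sum_(k < l1 + l2) (1 - (lam (rem (lift t k)))%:Z) + (1 - (lam (rem t))%:Z).
Proof.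
pose f k : int := 1 - (lam k)%:Z.
rewrite -addrA [X in _ + X]addrC.
rewrite -[X in _ + X](@bigD1_ord _ _ _ _ t predT (fun s => f (rem s))) //.
rewrite (big_remaining _ f vI hl) big_split_ord /=.
under eq_bigr => p _ do rewrite (unsplitK (inl _ _)).
under [X in _ + X + _]eq_bigr => q _ do rewrite (unsplitK (inr _ _)).
rewrite /hs -!addrA; congr (_ + (_ + _)).
have -> : \sum_(k < N.+1) (lam k)%:Z
    = \sum_(mu < eta) (lam (v mu))%:Z + \sum_(k | k \notin codom v) (lam k)%:Z.
  rewrite (bigID [pred k | k \in codom v]) /=; congr (_ + _).
  rewrite -big_uniq /= ?big_image //.
  by rewrite map_inj_uniq // enum_uniq.
rewrite addrAC subrr add0r big_split /= sumrN -(big_remaining _ (fun=> 1) vI hl).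
rewrite sumr_const card_ord.
have -> : N%:Z = (l1 + l2)%:Z + eta%:Z.
  by rewrite -PoszD; congr Posz; move: hl; rewrite addSn => -[].
rewrite [RHS]addrC; congr (_ + _).
by rewrite addrA addrK natz -PoszD addn1.
Qed.

(** The weight d_i - lambda_k + 1 of an entry splits into a row part d_i and a column part 1 -
    lambda_k, both of which come out of the determinant. *)
Lemma omega_loc_homogZ t z xi a : a != 0 ->
  omega_loc A lam v i j t (a *: z) (a *: xi)
  = a ^ hs * omega_loc A lam v i j t z xi.
Proof.
move=> a0; rewrite [LHS]omega_locE omega_locE.
pose ds (s : 'I_(l1 + l2)) := match split s with
    inl p => (d (i p))%:Z | inr q => (d (lshift r (j q)))%:Z end.
have hM (s k : 'I_(l1 + l2)) : col' t (Csub_eval (a *: z) (a *: xi)) s k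
    = a ^ ds s * a ^ (1 - (lam (rem (lift t k)))%:Z) * col' t (Csub_eval z xi) s k.
  rewrite -expfzDr // mxE [in RHS]mxE /ds addrCA addrC.
  case: (split_ordP s) => [p|q] ->.
    by rewrite !Csub_eval_lshift (Atilde_homogZ hA).
  by rewrite !Csub_eval_rshift (Bform_homogZ hA).
have -> : a ^ hs = a ^ (\sum_s ds s)
    * a ^ (\sum_(k < l1 + l2) (1 - (lam (rem (lift t k)))%:Z))
    * a ^- (lam (rem t)).-1.
  rewrite exprnN -!expfzDr // (heartE t); congr (_ ^ (_ + _)).
  by case: (lam _) (hlam (rem t)) => // l _; rewrite intS opprD addrA subrr add0r.
rewrite (det_scale_rows_cols hM) !prod_expz // mxE exprMn invfM.
rewrite -!mulrA ![in RHS](mulrCA _ ((-1) ^+ t)); congr (_ * _).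
rewrite ![in RHS](mulrCA _ (a ^- _)); congr (_ * _).
by rewrite ![in RHS](mulrCA _ (z 0 _ ^- _)).
Qed.

Lemma omega_loc_horizontal (hji : forall q, exists p, i p = lshift r (j q))
  t z xi s :
  omega_loc A lam v i j t z (xi + s *: z) = omega_loc A lam v i j t z xi.
Proof.
rewrite [LHS]omega_locE omega_locE; congr (_ * _).
have [f fE] := fin_all_exists hji.
pose M : 'M_(l1 + l2) := col' t (Csub_eval z xi).
(* Row [q] of [Z] has its single entry at [f q], the position of the A-row with the same index as
   the B-row; [hji] provides it. *)
pose Z : 'M_(l2, l1) :=
  \matrix_(q, p) if p == f q then s *+ d (lshift r (j q)) else 0.
rewrite -/M -[M]vsubmxK -(det_col_mx_addl _ _ Z); congr (\det _).
apply/matrixP=> e k; rewrite mxE; case: (split_ordP e) => [p|q] ->.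
  by rewrite col_mxEu Csub_eval_lshift mxE [RHS]mxE Csub_eval_lshift !sym_eval_Atilde.
rewrite col_mxEd Csub_eval_rshift (Bform_euler hA) mxE; congr (_ + _).
  by rewrite mxE [RHS]mxE Csub_eval_rshift.
rewrite mxE (bigD1 (f q)) //= big1 => [|p pf].
  rewrite addr0 [Z _ _]mxE eqxx [usubmx _ _ _]mxE [M _ _]mxE.
  by rewrite Csub_eval_lshift fE !sym_eval_Atilde.
by rewrite [Z _ _]mxE (negPf pf) mul0r.
Qed.

Lemma omega_hat_homogZ z xi a : a != 0 ->
  omega_hat A lam v i j (a *: z) (a *: xi)
  = a ^ hs * omega_hat A lam v i j z xi.
Proof.
move=> a0; rewrite /omega_hat.
(* Since [a] is nonzero, [pick] chooses the same chart at [z] and at [a *: z]. *)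
rewrite (eq_pick (Q := fun t : 'I_(l1 + l2).+1 => z 0 (rem t) != 0)) => [|t].
  by case: pickP => [t _|_]; rewrite ?mulr0 // omega_loc_homogZ.
by rewrite mxE mulf_eq0 (negPf a0).
Qed.

Lemma omega_hat_horizontal (hji : forall q, exists p, i p = lshift r (j q))
  z xi s :
  omega_hat A lam v i j z (xi + s *: z) = omega_hat A lam v i j z xi.
Proof.
by rewrite /omega_hat; case: pickP => // t _; rewrite omega_loc_horizontal.
Qed.

Lemma Chat_dhomog t : \det (Chat A lam v i j t) \is l2.-homog.
Proof.
(* Degrees in the dz_k: A-rows are functions, B-rows are 1-forms. *)
pose e (s : 'I_(l1 + l2)) : nat := if split s is inl _ then 0 else 1.
have eE : (\sum_s e s)%N = l2.
  rewrite big_split_ord /= /e.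
  under eq_bigr => p _ do rewrite (unsplitK (inl _ _)).
  under [X in (_ + X)%N]eq_bigr => q _ do rewrite (unsplitK (inr _ _)).
  by rewrite sum_nat_const muln0 sum_nat_const card_ord muln1.
suff : \det (Chat A lam v i j t) \is (\sum_s e s)%N.-homog by rewrite eE.
have h0 p : (p%:MP : symform K N.+1) \is 0.-homog.
  by rewrite -[p%:MP]mulr1 mul_mpolyC dhomogZ ?dhomog1.
have h1 k : dz K k \is 1.-homog by rewrite dhomogX /= mdeg1.
have hM p (G : symform K N.+1) : G \is 1.-homog -> p%:MP * G \is 1.-homog.
  exact: (dhomogM (h0 p)).
apply: dhomog_det => s k; rewrite mxE mxE /e.
case: (split_ordP s) => [p|q] ->.
  by rewrite sel_row_lshift col_mxEu mxE h0.
rewrite sel_row_rshift col_mxEd mxE rpredD ?hM ?h1 //.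
by apply: rpred_sum => m _; rewrite hM ?h1.
Qed.

Lemma omega_hat_regular :
  regular_sym_form (coneX A lam v) (tangent (fermatV A lam)) l2
    (omega_hat A lam v i j).
Proof.
move=> z0 /exists_remaining_neq0[t z0t].
exists ('X_(rem t) ^+ (lam (rem t)).-1).
exists ((-1) ^+ t * \det (Chat A lam v i j t)); split.
- by rewrite rmorphXn /= mevalXU expf_neq0.
- by rewrite -signr_odd mulr_sign; case: ifP => _; rewrite ?rpredN Chat_dhomog.
move=> z xi Yz; rewrite rmorphXn /= mevalXU => zt Tz.
(* The denominator is a positive power of z_(r_t), so where it is nonzero chart [t] is available. *)
rewrite (@omega_hatE t) //; last first.
  apply: contra zt => /eqP ->; have := hlam (rem t).
  by case: (lam _) => [|[|l]] // _; rewrite expr0n.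
rewrite /omega_loc mulrAC; congr (_ / _).
by rewrite sym_evalM /sym_eval !rmorphXn !rmorphN1.
Qed.

End Omega.

(** * Twisted sections and descent to the charts *)

Lemma twisted_section_mul (K : closedFieldType) (N m l e : nat) (h : int)
  (FV : 'I_m -> {mpoly K[N.+1]}) (Yhat : 'rV[K]_N.+1 -> Prop)
  (s : 'I_N.+1 -> 'rV[K]_N.+1 -> 'rV[K]_N.+1 -> K) (P : {mpoly K[N.+1]}) :
  P \is e.-homog -> twisted_section FV Yhat l h s ->
  twisted_section FV Yhat l (e%:Z + h) (mul_section P s).
Proof.
move=> hP [reg glue]; split.
  move=> k z0 /(reg k)[Q [G [Qz0 hG sE]]]; exists Q, (P%:MP * G); split=> //.
    by rewrite mul_mpolyC dhomogZ.
  move=> z xi Yz Qz Tz.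
  by rewrite /mul_section sE // sym_evalM sym_evalC mulrA.
(* The extra transition factor comes from P(x) = x_k'^e P(x / x_k'). *)
move=> k k' x w Yx Tx xk'; rewrite /mul_section (glue k k') //.
rewrite /to_chart (meval_homogZ _ _ hP) expfzDr // -exprnP exprVn.
by rewrite mulrACA mulVKf ?expf_neq0 // mulrCA.
Qed.

Theorem proposition6p12 (K : closedFieldType) (N c r : nat)
  (hN : (2 <= N)%N) (hcr1 : (N <= 2 * c + r)%N) (hcr2 : (c + r <= N - 1)%N)
  (n : nat) (hn : n = (N - (c + r))%N)
  (d : 'I_(c + r) -> nat) (hd : forall i, (0 < d i)%N)
  (lam : 'I_N.+1 -> nat) (hlam : forall k, (2 <= lam k)%N)
  (A : 'I_(c + r) -> 'I_N.+1 -> {mpoly K[N.+1]})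
  (* A_i^j is homogeneous with deg A_i^j + lambda_j = d_i (or zero) *)
  (hA : forall i k m, m \in msupp (A i k) -> (mdeg m + lam k)%N = d i)
  (hV : smooth_ci (fermatV A lam)) (hX : smooth_ci (fermat A lam))
  (eta : nat) (heta1 : (1 <= eta)%N) (heta2 : (eta <= n - 1)%N)
  (v : 'I_eta -> 'I_N.+1)
  (hv : forall a b : 'I_eta, (a < b)%N -> (v a < v b)%N)
  (l1 l2 : nat) (hl2 : (0 < l2)%N) (hl12 : (l2 <= l1)%N)
  (hl : (l1 + l2)%N = (c + r + n - eta)%N)
  (i : 'I_l1 -> 'I_(c + r))
  (hi : forall a b : 'I_l1, (a < b)%N -> (i a < i b)%N)
  (j : 'I_l2 -> 'I_c)
  (hj : forall a b : 'I_l2, (a < b)%N -> (j a < j b)%N)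
  (hji : forall q, exists p, i p = lshift r (j q)) :
  (* the glued form is well defined and regular on the cone, ... *)
  [/\ (forall (t : 'I_(l1 + l2).+1) z xi, coneX A lam v z -> tangent (fermatV A lam) z xi ->
         z 0 (remaining v t) != 0 ->
         omega_hat A lam v i j z xi = omega_loc A lam v i j t z xi),
      horizontal_section (fermatV A lam) (coneX A lam v) l2
        (omega_hat A lam v i j) &
  (* ... and it is the image of a twisted form omega *)
  exists omega : 'I_N.+1 -> 'rV[K]_N.+1 -> 'rV[K]_N.+1 -> K,
    [/\ twisted_section (fermatV A lam) (coneX A lam v) l2
          (heart d lam v i j) omega,
        (forall z xi, coneX A lam v z -> tangent (fermatV A lam) z xi ->
           pullback (heart d lam v i j) omega z xi
           = omega_hat A lam v i j z xi) &
        forall (e : nat) (P : {mpoly K[N.+1]}), P \is e.-homog ->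
          twisted_section (fermatV A lam) (coneX A lam v) l2
            (e%:Z + heart d lam v i j) (mul_section P omega)]].
Proof.
have vI : injective v.
  move=> a b vab; apply: val_inj; case: (ltngtP a b) => // /hv;
    by rewrite vab ltnn.
(* The bounds on [c + r] and [eta] make the truncated subtractions exact, so l1 + l2 = N - eta. *)
have hl' : ((l1 + l2).+1 + eta = N.+1)%N.
  by rewrite hl hn; lia.
have shift := omega_hat_horizontal hA v hji.
have scale (z xi : 'rV[K]_N.+1) (a : K) :=
  omega_hat_homogZ hlam hA vI hl' i j z xi (a := a).
have reg := omega_hat_regular hlam (A := A) vI hl' i j.
have chartE k (z xi : 'rV[K]_N.+1) : z 0 k != 0 ->
    z 0 k ^ heart d lam v i j
      * omega_hat A lam v i j (to_chart k z) (dto_chart k z xi)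
    = omega_hat A lam v i j z xi.
  move=> zk.
  (* Horizontality removes the multiple of [to_chart k z]; homogeneity then yields z_k^-heart, which
     cancels the prefactor. *)
  have -> : dto_chart k z xi
      = (z 0 k)^-1 *: xi + (- (xi 0 k / z 0 k)) *: to_chart k z.
    by rewrite /dto_chart /to_chart scalerA mulNr scaleNr -mulrA -invfM -expr2.
  rewrite shift scale ?invr_neq0 // mulrA exprz_inv -expfzDr // subrr.
  by rewrite expr0z mul1r.
(* The same function on the cone, restricted to each hyperplane x_k = 1, serves for all charts;
   [chartE] is the gluing condition. *)
have tw : twisted_section (fermatV A lam) (coneX A lam v) l2
    (heart d lam v i j) (fun=> omega_hat A lam v i j).
  split=> [k z0 [Yz0 _] | k k' x w _ _ xk']; last by rewrite chartE.
  have [Q [G [Qz0 hG sE]]] := reg _ Yz0; exists Q, G; split=> //.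
  by move=> z xi [Yz _] Qz [Tz _]; apply: sE.
split.
- by move=> t z xi; apply: omega_hatE.
- by split=> // z xi t _ _; apply: shift.
exists (fun=> omega_hat A lam v i j); split=> // [z xi Yz Tz | e P hP].
  rewrite /pullback; case: pickP => [k zk | z0]; first exact: chartE.
  case: Yz => -[/eqP[]]; apply/rowP=> k; rewrite mxE.
  by have /negbFE/eqP := z0 k.
exact: twisted_section_mul.
Qed.
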